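(* Let $H=\prod_p p^{a_p}<H'=\prod_p p^{b_p}$ be consecutive highly composite numbers with $L_-(H,H')=2$, and fix an admissible deletion order $r\mid s$ of the two required deletion layers (the layer with prime base $r$ is deleted first, the layer with prime base $s$ second). Suppose that at least one required insertion has prime base $q\ge s$ (i.e. there is a prime $q\ge s$ with $b_q>a_q$). Then $$\beta^{\mathrm{geo}}(H,H')\ge\frac12.$$ If in addition the first deletion is a support deletion $r^1\to r^0$ (i.e. it lowers the exponent of $r$ from $1$ to $0$), then $$\beta^{\mathrm{geo}}(H,H')=\frac12.$$
   Context: $d(n)$ denotes the number of positive divisors of $n$. A positive integer $H$ is highly composite if $d(m)<d(H)$ for all integers $1\le m<H$. Two highly composite numbers $H<H'$ are consecutive if no highly composite number lies strictly between them. Put $L_-(H,H')=\sum_p\max(a_p-b_p,0)$. A required deletion layer with prime base $p$ and level $j$ ($b_p<j\le a_p$) is the move lowering the exponent of $p$ from $j$ to $j-1$; a deletion order is admissible if within one prime coordinate the higher level is deleted before the lower one ($r=s$ is allowed). An exponent-lattice geodesic from $H$ to $H'$ is a sequence of positive integers starting at $H$ and ending at $H'$ in which each step changes the exponent of exactly one prime by one unit, always in the direction of its target exponent. It is $H'$-admissible if every vertex $z$ satisfies $z\le H'$. The normalised geodesic capacity is $$\beta^{\mathrm{geo}}(H,H')=\frac{1}{d(H)}\max_{\gamma}\min_{z\in\gamma}d(z),$$ where $\gamma$ ranges over the $H'$-admissible geodesics from $H$ to $H'$ and $z$ over all vertices of $\gamma$, endpoints included. *)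

(* Defs.v *)
From mathcomp Require Import all_boot all_order all_algebra.

Set Implicit Arguments.
Unset Strict Implicit.
Unset Printing Implicit Defensive.

Definition ndiv (n : nat) : nat := size (divisors n).

Definition highly_composite (H : nat) : Prop :=
  0 < H /\ forall m : nat, 0 < m -> m < H -> ndiv m < ndiv H.

Definition consecutive_hc (H H' : nat) : Prop :=
  [/\ highly_composite H, highly_composite H', H < H' &
      forall K : nat, highly_composite K -> ~~ (H < K < H')].

(* With a_p = logn p H and b_p = logn p H', the truncated subtraction is
   max(a_p - b_p, 0); it vanishes unless p divides H. *)
Definition Lminus (H H' : nat) : nat :=
  \sum_(p <- primes H) (logn p H - logn p H').

(* The layer (p, j) is the move lowering the exponent of p from j to j - 1. *)
Definition required_deletion (H H' : nat) (l : nat * nat) : bool :=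
  prime l.1 && (logn l.1 H' < l.2 <= logn l.1 H).

(* o lists every required deletion layer exactly once, in order of deletion;
   within one prime coordinate the levels decrease along o. *)
Definition admissible_deletion_order (H H' : nat) (o : seq (nat * nat)) : Prop :=
  [/\ uniq o,
      forall l, (l \in o) = required_deletion H H' l &
      pairwise (fun l1 l2 => (l1.1 == l2.1) ==> (l2.2 < l1.2)) o].

(* One unit step from x to y, in one prime exponent, towards the exponent of
   that prime in H'. Since primes 0 = [::], a step never involves 0. *)
Definition geo_step (H' x y : nat) : bool :=
  has (fun p => ((y == p * x) && (logn p x < logn p H'))
             || ((x == p * y) && (logn p H' < logn p x)))
      (primes (x * y)).

Definition geodesic (H H' : nat) (g : seq nat) : bool :=
  if g is x :: s then [&& x == H, path (geo_step H') x s & last x s == H']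
  else false.

Definition admissible_geodesic (H H' : nat) (g : seq nat) : bool :=
  geodesic H H' g && all (fun z => z <= H') g.

(* H is a vertex of every geodesic from H to H', so the default value ndiv H
   does not affect the minimum. *)
Definition geo_min (H : nat) (g : seq nat) : nat :=
  \big[minn/ndiv H]_(z <- g) ndiv z.

Definition geo_length (H H' : nat) : nat := Lminus H H' + Lminus H' H.

(* Every H'-admissible geodesic is a tuple of the type below: its vertices are
   at most H' and its size is given by geodesic_size. *)
Definition geo_capacity (H H' : nat) : nat :=
  \max_(g : (geo_length H H').+1.-tuple 'I_H'.+1
          | admissible_geodesic H H' (map val g)) geo_min H (map val g).

Definition beta_geo (H H' : nat) : rat :=
  ((geo_capacity H H')%:R / (ndiv H)%:R)%R.

Lemma Lminus_ord (N H H' : nat) : 0 < H -> H < N ->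
  Lminus H H' = \sum_(p < N) (logn p H - logn p H').
Proof.
move=> H0 HN.
rewrite -(big_mkord xpredT (fun p => logn p H - logn p H')) /Lminus.
rewrite [RHS](bigID (fun p => p \in primes H) xpredT) /= [X in _ + X]big1 ?addn0; last first.
  move=> p; rewrite -logn_gt0 lt0n negbK => /eqP->; exact: sub0n.
rewrite -[RHS]big_filter; apply: perm_big; apply: uniq_perm.
- exact: primes_uniq.
- by rewrite filter_uniq // iota_uniq.
move=> p; rewrite mem_filter mem_index_iota /=; case: (boolP (p \in primes H)) => //=.
rewrite mem_primes => /and3P[_ _ /(dvdn_leq H0) pH].
by rewrite (leq_ltn_trans pH HN).
Qed.

Lemma geo_step_length (H' x y : nat) : 0 < H' -> geo_step H' x y ->
  geo_length x H' = (geo_length y H').+1.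
Proof.
move=> H'0 /hasP[p]; rewrite mem_primes muln_gt0 => /and3P[pp /andP[x0 y0] _] st.
pose N := (x + y + H').+1.
have xN : x < N by rewrite ltnS -addnA leq_addr.
have yN : y < N by rewrite ltnS addnAC leq_addl.
have hN : H' < N by rewrite ltnS leq_addl.
have pN : p < N.
  by case/orP: st => /andP[/eqP e _]; [apply: leq_ltn_trans yN|apply: leq_ltn_trans xN];
     rewrite e leq_pmulr.
have E z : 0 < z -> z < N -> geo_length z H' =
  \sum_(q < N) ((logn q z - logn q H') + (logn q H' - logn q z)).
  by move=> z0 zN; rewrite /geo_length (Lminus_ord _ z0 zN) (Lminus_ord _ H'0 hN) big_split.
have step u v : 0 < u -> v = p * u -> logn p v = (logn p u).+1
    /\ forall q, q != p -> logn q v = logn q u.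
  move=> u0 ->; split.
    by rewrite (lognM p (prime_gt0 pp) u0) logn_prime // eqxx.
  move=> q qp; case: (boolP (prime q)) => pq.
    by rewrite (lognM q (prime_gt0 pp) u0) logn_prime // (negbTE qp).
  have l0 n : logn q n = 0 by rewrite lognE (negbTE pq).
  by rewrite !l0.
rewrite !E // (bigD1 (Ordinal pN)) //= [in RHS](bigD1 (Ordinal pN)) //= -addSn.
have dist a b : a < b -> (a - b + (b - a)) = (a.+1 - b + (b - a.+1)).+1.
  move=> ab; have /eqP-> : a - b == 0 by rewrite subn_eq0 ltnW.
  have /eqP-> : a.+1 - b == 0 by rewrite subn_eq0.
  by rewrite !add0n subnSK.
case/orP: st => /andP[/eqP e lt].
- have [e1 e2] := step _ _ x0 e; congr (_ + _); first by rewrite e1 dist.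
  by apply: eq_bigr => q; rewrite -val_eqE /= => qp; rewrite e2.
- have [e1 e2] := step _ _ y0 e; congr (_ + _).
    move: lt; rewrite e1 ltnS => lt.
    have /eqP-> : logn p H' - (logn p y).+1 == 0 by rewrite subn_eq0 leqW.
    have /eqP-> : logn p H' - logn p y == 0 by rewrite subn_eq0.
    by rewrite !addn0 subSn.
  by apply: eq_bigr => q; rewrite -val_eqE /= => qp; rewrite e2.
Qed.

Lemma geodesic_size (H H' : nat) (g : seq nat) :
  0 < H' -> geodesic H H' g -> size g = (geo_length H H').+1.
Proof.
move=> H'0; case: g => //= x s /and3P[/eqP <- + /eqP E].
elim: s x E => [|y s IH] x /=.
  move=> <- _; rewrite /geo_length /Lminus.
  by rewrite big1 // => p _; rewrite subnn.
by move=> E /andP[st ps]; rewrite (geo_step_length H'0 st) (IH y).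
Qed.

Lemma geo_min_le_capacity (H H' : nat) (g : seq nat) :
  0 < H' -> admissible_geodesic H H' g -> geo_min H g <= geo_capacity H H'.
Proof.
move=> H'0 /[dup] ag /andP[/(geodesic_size H'0) sg /allP le].
pose t : seq 'I_H'.+1 := map inord g.
have vt : map val t = g.
  rewrite -map_comp -[RHS]map_id; apply/eq_in_map => z /le zH /=.
  by rewrite inordK.
have st : size t == (geo_length H H').+1 by rewrite size_map sg.
rewrite /geo_capacity -vt; apply: (bigmax_sup (Tuple st)) => //=.
by rewrite vt.
Qed.

(* Main.v *)
Require Import Defs.
From mathcomp Require Import all_boot all_order all_algebra.
From mathcomp Require Import zify.

Set Implicit Arguments.
Unset Strict Implicit.
Unset Printing Implicit Defensive.

(** Lower bound: write [H' = q K] and consider the geodesic that deletes [r],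
    then makes all required insertions except one copy of [q], then deletes
    [s], then inserts [q].  The insertions climb from [H / r] to
    [s K <= q K = H'], so the path is admissible, and the divisor function is
    at least [min (d (H / r)) (d K)] along it.  Both are at least [d H / 2],
    since removing one prime factor at most halves [d] and [d H' > d H].

    Upper bound: a geodesic that has to remove [r] from the support makes a
    step from [r y] to [y] with [r] not dividing [y].  There [r y < H'], so that
    [2 d y = d (r y) <= d H]. *)

Import Order.TTheory GRing.Theory Num.Theory.

(** * Exponents and divisor counts *)

Lemma logn_primeM p r x : prime r -> 0 < x ->
  logn p (r * x) = (p == r) + logn p x.
Proof.
move=> pr x0; case: (boolP (prime p)) => [pp|/negbTE np].
  by rewrite (lognM _ (prime_gt0 pr) x0) logn_prime.
have -> : (p == r) = false by apply: contraFF np => /eqP->.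
by rewrite lognE np [in RHS]lognE np.
Qed.

Lemma ndiv_gt0 n : 0 < n -> 0 < ndiv n.
Proof.
move=> n0; rewrite /ndiv -has_predT; apply/hasP; exists 1 => //.
by rewrite -dvdn_divisors.
Qed.

Lemma ndiv_dvd m n : 0 < n -> m %| n -> ndiv m <= ndiv n.
Proof.
move=> n0 mn; have m0 := dvdn_gt0 n0 mn.
apply: uniq_leq_size; first exact: divisors_uniq.
by move=> e; rewrite -!dvdn_divisors // => /dvdn_trans; apply.
Qed.

(** A divisor of [p * x] not divisible by [p] divides [x]; any other is [p] times a divisor of
    [x]. *)
Lemma ndiv_primeM p x : prime p -> 0 < x -> ndiv (p * x) <= 2 * ndiv x.
Proof.
move=> pp x0; have px0 : 0 < p * x by rewrite muln_gt0 prime_gt0.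
have -> : 2 * ndiv x = size (divisors x ++ map (muln p) (divisors x)).
  by rewrite size_cat size_map mul2n addnn.
apply: uniq_leq_size; first exact: divisors_uniq.
move=> e; rewrite -dvdn_divisors // mem_cat -dvdn_divisors // => epx.
case: (boolP (p %| e)) => [/dvdnP[f ef]|npe].
  apply/orP; right; apply/mapP; exists f; last by rewrite mulnC.
  by rewrite -dvdn_divisors //; move: epx; rewrite ef mulnC dvdn_pmul2l ?prime_gt0.
by rewrite -(@Gauss_dvdr _ p) ?epx // coprime_sym prime_coprime.
Qed.

Lemma ndiv_primeM_coprime p x : prime p -> 0 < x -> ~~ (p %| x) ->
  2 * ndiv x <= ndiv (p * x).
Proof.
move=> pp x0 npx; have px0 : 0 < p * x by rewrite muln_gt0 prime_gt0.
have -> : 2 * ndiv x = size (divisors x ++ map (muln p) (divisors x)).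
  by rewrite size_cat size_map mul2n addnn.
apply: uniq_leq_size.
  rewrite cat_uniq divisors_uniq map_inj_uniq ?divisors_uniq ?andbT /=; last first.
    by move=> a b /eqP; rewrite eqn_pmul2l ?prime_gt0 // => /eqP.
  apply/hasPn => _ /mapP[f _ ->]; rewrite /= -dvdn_divisors //.
  by apply: contra npx; apply: dvdn_trans; rewrite dvdn_mulr.
move=> e; rewrite mem_cat -!dvdn_divisors // => /orP[ex|/mapP[f + ->]].
  exact: dvdn_mull.
by rewrite -dvdn_divisors // dvdn_pmul2l ?prime_gt0.
Qed.

(** A least counterexample [m] would itself be highly composite. The gap then forces [m <= H],
    against [highly_composite H]. *)
Lemma consecutive_hc_ndiv_le {H H'} : consecutive_hc H H' ->
  forall m, 0 < m -> m < H' -> ndiv m <= ndiv H.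
Proof.
case=> [[H0 hH] _ _ gap] m.
elim/ltn_ind: m => m IH m0 mH'; rewrite leqNgt; apply/negP => Hm.
have hm : highly_composite m.
  split=> // k k0 km; apply: leq_ltn_trans Hm.
  by apply: IH => //; apply: ltn_trans mH'.
move: (gap m hm); rewrite mH' andbT -leqNgt leq_eqVlt => /orP[/eqP e|mH].
  by rewrite e ltnn in Hm.
by have := ltn_trans Hm (hH m m0 mH); rewrite ltnn.
Qed.

(** * Unit steps and lattice paths *)

Lemma geo_step_insert H' p x : prime p -> 0 < x -> logn p x < logn p H' ->
  geo_step H' x (p * x).
Proof.
move=> pp x0 lt; apply/hasP; exists p; last by rewrite eqxx lt.
by rewrite mem_primes pp !muln_gt0 x0 prime_gt0 //= mulnCA dvdn_mulr.
Qed.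

Lemma geo_step_delete H' p x : prime p -> 0 < x ->
  logn p H' < logn p (p * x) -> geo_step H' (p * x) x.
Proof.
move=> pp x0 lt; apply/hasP; exists p; last by rewrite eqxx lt orbT.
by rewrite mem_primes pp !muln_gt0 x0 prime_gt0 //= -mulnA dvdn_mulr.
Qed.

Lemma insertion_path H' x y : 0 < y -> x %| y ->
  (forall p, logn p x < logn p y -> logn p y <= logn p H') ->
  exists2 g, path (geo_step H') x g /\ last x g = y
           & forall z, z \in g -> (x %| z) && (z %| y).
Proof.
move=> y0; have [n] := ubnP (y - x); elim: n x => // n IH x yxn xy le.
have x0 := dvdn_gt0 y0 xy.
case: (eqVneq x y) => [<-|nxy]; first by exists [::].
have xlty : x < y by rewrite ltn_neqAle nxy dvdn_leq.
have [k ey] := dvdnP xy.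
have k1 : 1 < k by rewrite -(ltn_pmul2r x0) mul1n -ey.
have pp := pdiv_prime k1; set p := pdiv k in pp.
have pxy : p * x %| y by rewrite ey dvdn_pmul2r // pdiv_dvd.
have lpx : logn p (p * x) = (logn p x).+1 by rewrite logn_primeM // eqxx.
have lxy : logn p x < logn p y by rewrite -lpx; apply: dvdn_leq_log.
have xpx : x < p * x by rewrite ltn_Pmull // prime_gt1.
have [||q ltq|g [pg lg] gP] := IH (p * x) => //.
- by rewrite -ltnS; apply: leq_trans yxn; rewrite ltnS; apply: ltn_sub2l.
- by apply: le; apply: leq_ltn_trans ltq; rewrite logn_primeM // leq_addl.
exists (p * x :: g) => /=.
  by rewrite geo_step_insert // (leq_trans lxy) // le.
move=> z; rewrite inE => /orP[/eqP->|/gP/andP[pxz zy]].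
  by rewrite dvdn_mull.
by rewrite zy (dvdn_trans _ pxz) // dvdn_mull.
Qed.

Lemma dvdn_logn m n : 0 < m -> 0 < n ->
  (forall p, prime p -> logn p m <= logn p n) -> m %| n.
Proof.
move=> m0 n0 le; apply/dvdn_partP => // p; rewrite mem_primes => /and3P[pp _ _].
by rewrite p_part pfactor_dvdn ?le.
Qed.

(** Take the first vertex [y] not divisible by [r]: an insertion would have kept the factor [r], so
    the step into [y] deletes [r]. *)
Lemma geodesic_drop_prime H' r x g : prime r -> r %| x ->
  ~~ (r %| last x g) -> path (geo_step H') x g ->
  exists y, [/\ 0 < y, ~~ (r %| y), r * y \in x :: g & y \in g].
Proof.
move=> pr; elim: g x => [|y g IH] x rx; first by rewrite /= rx.
move=> /= nl /andP[/hasP[p pm st] pg].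
case: (boolP (r %| y)) => [ry|nry].
  have [z [z0 nz zm zg]] := IH y ry nl pg.
  by exists z; split; rewrite // in_cons ?zm ?zg orbT.
move: pm; rewrite mem_primes muln_gt0 => /and3P[pp /andP[x0 y0] _].
case/orP: st => /andP[/eqP e _].
  by rewrite e dvdn_mull in nry.
have rp : r = p.
  by apply/eqP; move: rx; rewrite e Euclid_dvdM // (negbTE nry) orbF dvdn_prime2.
by exists y; split; rewrite // ?inE ?eqxx // rp e eqxx.
Qed.

(** The first hypothesis handles the default value of the minimum; the factor 2 expresses a bound by
    one half within the naturals. *)
Lemma geo_min_geq H g c : c <= 2 * ndiv H ->
  (forall z, z \in g -> c <= 2 * ndiv z) -> c <= 2 * geo_min H g.
Proof.
move=> cH cg; rewrite /geo_min big_seq.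
elim/big_ind: _ => // a b; lia.
Qed.

Lemma geo_min_leq H g z : z \in g -> geo_min H g <= ndiv z.
Proof.
rewrite /geo_min; elim: g => // a g IH; rewrite inE big_cons geq_min.
by case/orP=> [/eqP->|/IH->]; rewrite ?leqnn ?orbT.
Qed.

(** The levels listed with base [p] are exactly the integers above [logn p H'] and up to [logn p H],
    so the difference counts them. *)
Lemma two_deletions H H' r i s j p :
  admissible_deletion_order H H' [:: (r, i); (s, j)] -> prime p ->
  logn p H - logn p H' = (p == r) + (p == s).
Proof.
case=> /= + mem + pp; rewrite inE !andbT => neq ord.
have m l : ((p == r) && (l == i)) || ((p == s) && (l == j)) =
    (logn p H' < l <= logn p H).
  by have := mem (p, l); rewrite !inE /required_deletion /= pp !xpair_eqE.
move: neq ord; rewrite xpair_eqE; move: (logn p H) (logn p H') m => a b m neq ord.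
have mP l : b < l -> l <= a -> p = r /\ l = i \/ p = s /\ l = j.
  move=> bl la; have := m l; rewrite bl la.
  by case/orP=> /andP[/eqP-> /eqP->]; [left|right].
case: (eqVneq p r) => [pr|/eqP npr]; case: (eqVneq p s) => [ps|/eqP nps].
- have rs : r = s by rewrite -pr.
  rewrite rs eqxx /= in ord.
  have := m i; rewrite pr !eqxx => /esym/andP[bi ia].
  have := m j; rewrite ps !eqxx orbT => /esym/andP[bj ja].
  (* Since [j < i], at least two levels are present; a third would make [b.+1], [b.+2] and [a] three
     distinct values among [i] and [j]. *)
  have := mP a; have := mP b.+1; have := mP b.+2; clear m mP; lia.
- have := m i; rewrite pr !eqxx => /esym/andP[bi ia].
  have := mP a; have := mP b.+1; clear m mP; lia.
- have := m j; rewrite ps !eqxx orbT => /esym/andP[bj ja].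
  have := mP a; have := mP b.+1; clear m mP; lia.
- have := mP a; clear m mP; lia.
Qed.

(** * The two bounds on the capacity *)

Lemma capacity_lower_bound H H' r i s j q :
  consecutive_hc H H' ->
  admissible_deletion_order H H' [:: (r, i); (s, j)] ->
  prime q -> s <= q -> logn q H < logn q H' ->
  ndiv H <= 2 * geo_capacity H H'.
Proof.
move=> [[H0 hH] [H'0 hH'] HH' _] ord pq sq ltq.
have [_ mem _] := ord.
have [pr rH] : prime r /\ r %| H.
  have := mem (r, i); rewrite inE eqxx /required_deletion /= => /esym/and3P[pr lt le].
  by split=> //; move: (leq_trans (leq_ltn_trans (leq0n _) lt) le); rewrite logn_gt0 mem_primes => /and3P[].
have ps : prime s.
  by have := mem (s, j); rewrite !inE eqxx orbT => /esym/andP[].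
have qH' : q %| H'.
  by move: (leq_ltn_trans (leq0n _) ltq); rewrite logn_gt0 mem_primes => /and3P[].
have [x eH] := dvdnP rH; rewrite mulnC in eH.
have [K eH'] := dvdnP qH'; rewrite mulnC in eH'.
have x0 : 0 < x by move: H0; rewrite eH muln_gt0 => /andP[].
have K0 : 0 < K by move: H'0; rewrite eH' muln_gt0 => /andP[].
have dl p : prime p -> logn p H - logn p H' = (p == r) + (p == s).
  exact: two_deletions ord.
have lH p : logn p H = (p == r) + logn p x by rewrite eH logn_primeM.
have lH' p : logn p H' = (p == q) + logn p K by rewrite eH' logn_primeM.
have lsK p : logn p (s * K) = (p == s) + logn p K by rewrite logn_primeM.
(* The exponent of [q] increases, so the truncated difference in [dl] vanishes at [q]. *)
have qr : q != r by have := dl q pq; lia.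
have qs : q != s by have := dl q pq; lia.
have sK0 : 0 < s * K by rewrite muln_gt0 prime_gt0.
have xsK : x %| s * K.
  apply: dvdn_logn => // p pp; rewrite lsK.
  case: (eqVneq p q) => [->|npq].
    move: ltq; rewrite lH lH' eqxx (negbTE qr) (negbTE qs) !add0n add1n.
    by rewrite ltnS.
  have := dl p pp; rewrite lH lH' (negbTE npq) add0n; clear; lia.
(* Only at [s] could [s * K] exceed the target exponent, but there [x] already has the exponent of
   [s * K], so nothing is inserted. *)
have [p|g [pg lg] gP] := @insertion_path H' _ _ sK0 xsK.
  rewrite lsK; case: (boolP (prime p)) => [pp|np].
    have := dl p pp; rewrite lH lH'; clear; lia.
  have -> : (p == s) = false by apply: contraNF np => /eqP->.
  by rewrite lH' leq_add2r.
pose G := [:: H, x & g] ++ [:: K; H'].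
have agG : admissible_geodesic H H' G.
  rewrite /admissible_geodesic /= eqxx cat_path pg last_cat /= lg eqxx !andbT.
  have KH' : K <= H' by rewrite eH' leq_pmull ?prime_gt0.
  rewrite all_cat /= leqnn (ltnW HH') KH' /= !andbT.
  (* This is where [s <= q] enters: [s * K] is a multiple of every vertex of the insertion
     stretch. *)
  have sKH' : s * K <= H' by rewrite eH' leq_mul2r sq orbT.
  apply/and3P; split.
  - apply/and3P; split.
    + by rewrite eH; apply: geo_step_delete => //; rewrite -eH; have := dl r pr; lia.
    + by apply: geo_step_delete => //; rewrite lsK lH' eqxx eq_sym (negbTE qs).
    + by rewrite [X in geo_step _ _ X]eH'; apply: geo_step_insert => //; rewrite lH' eqxx.
  - by apply: leq_trans sKH'; apply: dvdn_leq.
  - by apply/allP => z /gP/andP[_ zsK]; apply: leq_trans sKH'; apply: dvdn_leq.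
apply: leq_trans (_ : 2 * geo_min H G <= _); last first.
  by rewrite leq_mul2l geo_min_le_capacity.
have dx : ndiv H <= 2 * ndiv x by rewrite eH; apply: ndiv_primeM.
have dH' : ndiv H < ndiv H' by apply: hH'.
have dK : ndiv H' <= 2 * ndiv K by rewrite eH'; apply: ndiv_primeM.
apply: geo_min_geq; first by lia.
move=> z; rewrite mem_cat !inE -!orbA => /or4P[/eqP->|/eqP->|zg|/orP[]/eqP->]; try lia.
have /andP[xz zsK] := gP z zg.
apply: leq_trans dx _; rewrite leq_mul2l; apply: ndiv_dvd xz.
exact: dvdn_gt0 zsK.
Qed.

Lemma capacity_upper_bound H H' r :
  consecutive_hc H H' -> prime r -> r %| H -> ~~ (r %| H') ->
  2 * geo_capacity H H' <= ndiv H.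
Proof.
move=> cons pr rH nrH'; have [_ [H'0 _] _ _] := cons.
(* Moving the factor 2 to the right as a half leaves a bare maximum, to be bounded one geodesic at a
   time. *)
rewrite mul2n -geq_half_double; apply/bigmax_leqP => t /andP[].
case: (map val t) => // x g /and3P[/eqP-> pg /eqP lg] /allP le.
rewrite -lg in nrH'.
have [y [y0 ny ry yg]] := geodesic_drop_prime pr rH nrH' pg.
(* Admissibility gives only [<=]; equality is excluded because [r] does not divide [H']. *)
have ryH' : r * y < H'.
  rewrite ltn_neqAle le // andbT; apply: contraNneq nrH' => e.
  by rewrite lg -e dvdn_mulr.
have yHg : y \in H :: g by rewrite inE yg orbT.
rewrite geq_half_double -mul2n; apply: leq_trans (_ : 2 * ndiv y <= _).
  by rewrite leq_mul2l geo_min_leq.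
apply: leq_trans (ndiv_primeM_coprime pr y0 ny) _.
by apply: (consecutive_hc_ndiv_le cons) ryH'; rewrite muln_gt0 prime_gt0.
Qed.

Theorem theorem6p1 (H H' r i s j : nat)
    (Hcons : consecutive_hc H H')
    (HL : Lminus H H' = 2)
    (Hord : admissible_deletion_order H H' [:: (r, i); (s, j)])
    (Hins : exists q : nat, [/\ prime q, s <= q & logn q H < logn q H']) :
  (1 / 2%:R <= beta_geo H H')%R /\
  (i = 1 -> (beta_geo H H' = 1 / 2%:R)%R).
Proof.
have [q [pq sq ltq]] := Hins.
have [[H0 _] _ _ _] := Hcons.
have dH0 : (0 < (ndiv H)%:R :> rat)%R by rewrite ltr0n ndiv_gt0.
have lower : (1 / 2%:R <= beta_geo H H')%R.
  rewrite /beta_geo ler_pdivrMr // mulrAC ler_pdivlMr // mul1r -natrM ler_nat.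
  by rewrite mulnC (capacity_lower_bound Hcons Hord pq).
split=> // i1; apply/eqP; rewrite eq_le lower andbT.
rewrite /beta_geo ler_pdivrMr // mulrAC ler_pdivlMr // mul1r -natrM ler_nat.
have [_ mem _] := Hord.
(* Level 1 being a required deletion means that [r] divides [H] but not [H']. *)
have := mem (r, i); rewrite inE eqxx i1 /required_deletion /= => /esym/and3P[pr].
rewrite ltnS leqn0 => /eqP b0; rewrite logn_gt0 mem_primes => /and3P[_ _ rH].
rewrite mulnC; apply: (capacity_upper_bound Hcons pr rH).
have [_ [H'0 _] _ _] := Hcons.
by apply: contra_eqN b0 => rH'; rewrite -lt0n logn_gt0 mem_primes pr H'0.
Qed.
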